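(* Let $k$ be a positive integer. If $k\equiv 2\pmod 4$, then the Möbius ladder $M_k$ is not cordial.
   Context: Graphs are finite and may have multiple edges but not loops. A binary labeling of a graph $G$ is a function $f:V(G)\to\{0,1\}$. Two real numbers $x,y$ are roughly equal if $0\le |x-y|\le 1$. A binary labeling $f$ is friendly if $|f^{-1}(0)|$ and $|f^{-1}(1)|$ are roughly equal. A binary labeling $f$ induces an edge labeling $f_e:E(G)\to\{0,1\}$ by $f_e(uv)=f(u)+f(v)$ modulo 2. A friendly labeling $f$ of $G$ is cordial if $|f_e^{-1}(0)|$ and $|f_e^{-1}(1)|$ are roughly equal; a graph is cordial if it has a cordial labeling. The Möbius ladder $M_k$ consists of the cycle $C_{2k}$ together with $k$ additional edges joining the opposite pairs of vertices of the cycle. *)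

(* Defs.v *)
From mathcomp Require Import all_boot all_order all_algebra.

Set Implicit Arguments.
Unset Strict Implicit.
Unset Printing Implicit Defensive.

Import GRing.Theory Num.Theory.

(* Finite loopless multigraphs: edges form their own finite type, so distinct
   edges may have the same set of endpoints. *)
Record multigraph := Multigraph {
  vertex : finType;
  edge : finType;
  ends : edge -> {set vertex};
  card_ends : forall e, #|ends e| = 2
}.

Definition roughly_equal (R : realDomainType) (x y : R) : bool :=
  (0 <= `|x - y| <= 1)%R.

Section Labelings.

Variable G : multigraph.

Definition binary_labeling := vertex G -> 'Z_2.

Implicit Type f : binary_labeling.

Definition friendly f : bool :=
  roughly_equal #|f @^-1: [set 0%R]|%:Z%R #|f @^-1: [set 1%R]|%:Z%R.

(* The sum is taken in 'Z_2 over the two endpoints of e; see edge_labelE. *)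
Definition edge_label f (e : edge G) : 'Z_2 := (\sum_(v in ends e) f v)%R.

Lemma edge_labelE f e u v :
  ends e = [set u; v] -> edge_label f e = (f u + f v)%R.
Proof.
move=> ends_e; have := card_ends e; rewrite /edge_label ends_e cards2.
by case: eqVneq => // neq_uv _; rewrite big_setU1 ?inE // big_set1.
Qed.

Definition cordial_labeling f : bool :=
  friendly f &&
  roughly_equal #|edge_label f @^-1: [set 0%R]|%:Z%R
                #|edge_label f @^-1: [set 1%R]|%:Z%R.

Definition cordial : Prop := exists f, cordial_labeling f.

End Labelings.

(* The vertices of the cycle C_2k are 0, ..., 2k - 1 in cyclic order.  The edge
   inl i of the cycle joins i to i + 1 mod 2k; the edge inr i joins the
   opposite vertices i and k + i, for i < k. *)
Definition mobius_ends k (e : 'I_(k + k) + 'I_k) : {set 'I_(k + k)} :=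
  match e with
  | inl i => [set i; ordS i]
  | inr i => [set lshift k i; rshift k i]
  end.

Lemma card_mobius_ends k (e : 'I_(k + k) + 'I_k) : #|mobius_ends e| = 2.
Proof.
case: e => i /=; rewrite cards2; last by rewrite eq_lrshift.
suff -> : i != ordS i by [].
rewrite -val_eqE /=; have := ltn_ord i; rewrite leq_eqVlt => /orP[/eqP Ei|lti].
  rewrite Ei modnn; case: (nat_of_ord i) Ei => // Ek.
  by move/(congr1 odd): Ek; rewrite addnn odd_double.
by rewrite modn_small // neq_ltn ltnSn.
Qed.

Definition mobius_ladder k : multigraph :=
  Multigraph (@card_mobius_ends k).

(* Main.v *)
(* Every vertex of M_k has odd degree, so modulo 2 the edge labels sum to the
   sum of the vertex labels.  There are 2k vertices and 3k edges, both even, so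
   a cordial labeling has exactly k vertices and exactly 3k/2 edges of label 1;
   but k is even while 3k/2 is odd. *)
Require Import Defs.
From mathcomp Require Import all_boot all_order all_algebra.
From mathcomp Require Import zify.

Import GRing.Theory.

(** Numbers of equal parity cannot differ by exactly 1. *)
Lemma roughly_equal_nat (m n : nat) :
  roughly_equal m%:Z%R n%:Z%R -> ~~ odd (m + n) -> m = n.
Proof. rewrite /roughly_equal; lia. Qed.

Lemma card_preim_Z2 (T : finType) (x : T -> 'Z_2) :
  #|x @^-1: [set 0%R]| + #|x @^-1: [set 1%R]| = #|T|.
Proof.
rewrite -(cardsC (x @^-1: [set 0%R])); congr (_ + _); apply: eq_card => t.
by rewrite !inE; case: (x t) => -[|[|//]].
Qed.

Lemma sum_Z2 (T : finType) (x : T -> 'Z_2) :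
  (\sum_t x t = #|x @^-1: [set 1]|%:R)%R.
Proof.
rewrite (bigID (mem (x @^-1: [set 1%R]))) /= [X in (_ + X)%R]big1 ?addr0.
  rewrite -sumr_const; apply: eq_bigr => t.
  by rewrite !inE => /eqP.
move=> t; rewrite !inE => xt_neq1; apply/val_inj.
by case: (x t) xt_neq1 => -[|[|]].
Qed.

(** By parity each label occurs exactly [n] times, and the sum counts the labels 1. *)
Lemma sum_balanced (T : finType) (x : T -> 'Z_2) (n : nat) :
    #|T| = n.*2 ->
    roughly_equal #|x @^-1: [set 0%R]|%:Z%R #|x @^-1: [set 1%R]|%:Z%R ->
  (\sum_t x t = n%:R)%R.
Proof.
move=> cardT /roughly_equal_nat; rewrite sum_Z2 card_preim_Z2 cardT odd_double.
move/(_ isT) => eq01; congr (_%:R)%R.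
by apply: double_inj; rewrite -cardT -(card_preim_Z2 _ x) eq01 addnn.
Qed.

Lemma sum_edge_label_mobius (k : nat) (f : binary_labeling (mobius_ladder k)) :
  (\sum_e edge_label f e = \sum_v f v)%R.
Proof.
have lab_cycle (i : 'I_(k + k)) :
    (@edge_label (mobius_ladder k) f (inl i) = f i + f (ordS i))%R.
  exact: edge_labelE.
have lab_rung (i : 'I_k) :
    (@edge_label (mobius_ladder k) f (inr i)
       = f (lshift k i) + f (rshift k i))%R.
  exact: edge_labelE.
rewrite big_sumType /= (eq_bigr _ (fun i _ => lab_cycle i)).
(* The rungs meet each vertex exactly once, so they contribute the whole vertex sum. *)
rewrite (eq_bigr _ (fun i _ => lab_rung i)) !big_split /= -(big_split_ord _ xpredT f).
(* [ordS] permutes the vertices, so the cycle contributes twice the vertex sum, which is 0 in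
   ['Z_2]. *)
have <- : (\sum_(i < k + k) f i = \sum_(i < k + k) f (ordS i))%R.
  exact: reindex_inj (@ordS_inj _).
by rewrite -mulr2n -mulr_natl pchar_Zp // mul0r add0r.
Qed.

Theorem lemma1 (k : nat) (k_gt0 : 0 < k) (k_mod4 : k = 2 %[mod 4]) :
  ~ cordial (mobius_ladder k).
Proof.
case=> f /andP[friendly_f balanced_e].
have card_v : #|vertex (mobius_ladder k)| = k.*2 by rewrite card_ord addnn.
have card_e : #|edge (mobius_ladder k)| = (k + k./2).*2.
  by rewrite card_sum !card_ord; lia.
have := sum_edge_label_mobius _ f.
rewrite (sum_balanced _ _ _ card_v friendly_f).
rewrite (sum_balanced _ _ _ card_e balanced_e).
(* Cancelling [k] leaves [k./2 = 0] in ['Z_2], but [k./2] is odd. *)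
rewrite natrD -[RHS]addr0 => /addrI /(congr1 val).
by rewrite /= val_Zp_nat //=; lia.
Qed.
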